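(* Let $n\ge 1$ and let $K,H\subset V_{2n}$ be subsets with property $(\ast)$ and $|K|=|H|=n+1$. Put $k=|K\cap H|-1$. Then $$\Delta_{K}\cdot \Delta_{H}=\Delta_{K\cap H}\cdot \left(\sum_{i=0}^{k}(-1)^{i}X^{i}\cdot \mathfrak{S}_{k-i}(M_{v}\mid v\notin K\cup H) \right)\in H^{4n}(\mathcal{GQ}_{2n}),$$ where $\Delta_\emptyset:=0$, $X=M_v+M_{\overline{v}}\in H^2(\mathcal{GQ}_{2n})$ (independent of $v\in V_{2n}$), and $\mathfrak{S}_j$ denotes the elementary symmetric polynomial of degree $j$.
   Context: **GKM graph $\mathcal{GQ}_{2n}$.** Vertices $V_{2n}=[2n+2]=\{1,\dots,2n+2\}$; for $i\in V_{2n}$ put $\overline{i}=2n+3-i$. Edges $E_{2n}=\{ij : i,j\in V_{2n},\ j\ne i,\overline{i}\}$. Identify $H^*(BT^{n+1})=\mathbb{Z}[x_1,\dots,x_{n+1}]$ with $\deg x_i=2$, and put $x_0=0$. Define $f:V_{2n}\to H^2(BT^{n+1})$ by $f(j)=x_{j-1}-x_{n+1}$ for $1\le j\le n+2$ and $f(j)=x_n-x_{2n+2-j}$ for $n+3\le j\le 2n+2$, and $\alpha(ij)=f(j)-f(i)$ for $ij\in E_{2n}$. **Graph equivariant cohomology.** $H^*(\mathcal{GQ}_{2n})=\{h:V_{2n}\to H^*(BT^{n+1}) : h(i)-h(j)\equiv 0 \bmod \alpha(ij)\text{ for all } ij\in E_{2n}\}$, with pointwise ring operations; $H^t(\mathcal{GQ}_{2n})$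 consists of those $h$ with values in $H^t(BT^{n+1})$. **Elements.** For $v\in V_{2n}$: $M_v(v)=0$; $M_v(j)=f(v)-f(j)$ for $j\ne v,\overline{v}$; $M_v(\overline{v})=x_n-x_{n+1}-2f(\overline{v})$. A non-empty $K\subset V_{2n}$ has property $(\ast)$ if $\{i,\overline{i}\}\not\subset K$ for all $i\in V_{2n}$. For such $K$: $\Delta_K(j)=\prod_{k\notin K\cup\{\overline{j}\}}(f(k)-f(j))$ for $j\in K$, and $\Delta_K(j)=0$ for $j\notin K$. The elementary symmetric polynomial is $\mathfrak{S}_j(r_i\mid i=1,\dots,m)=\sum_{a_1+\cdots+a_m=j,\ 0\le a_i\le1}r_1^{a_1}\cdots r_m^{a_m}$. *)

(* Defs.v *)
From mathcomp Require Import all_boot all_order all_algebra.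
From mathcomp Require Export mpoly.

Set Implicit Arguments.
Unset Strict Implicit.
Unset Printing Implicit Defensive.

Import GRing.Theory.
Local Open Scope ring_scope.

(* The ordinal i, of value 0, ..., 2n+1, stands for the vertex i + 1 of [2n+2]. *)
Notation V n := 'I_(n.*2.+2).

(* rev_ord i has value 2n+1-i; it is the vertex 2n+3-(i+1) = 2n+2-i. *)
Definition bar n (i : V n) : V n := rev_ord i.

Definition edge n (i j : V n) : bool := (j != i) && (j != bar i).

Definition HBT n := {mpoly int[n.+1]}.

(* deg x_i = 2, so H^t(BT) is {0} for odd t. *)
Definition in_HBT n (t : nat) (p : HBT n) : bool :=
  all (fun m => (2 * mdeg m == t)%N) (msupp p).

(* x_0 = 0, and x_1, ..., x_{n+1} are the variables 'X_0, ..., 'X_n;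
   only used for k <= n + 1. *)
Definition x n (k : nat) : HBT n :=
  if k is k'.+1 then 'X_(inord k' : 'I_n.+1) else 0.

Definition f n (i : V n) : HBT n :=
  let j := i.+1 in
  if (j <= n + 2)%N then x n (j - 1) - x n (n + 1)
  else x n n - x n (2 * n + 2 - j).

Definition alpha n (i j : V n) : HBT n := f j - f i.

(* Elements of the graph cohomology live in the pointwise ring of functions. *)
Notation VFun n := {ffun V n -> HBT n}.

Definition in_H n (h : VFun n) : Prop :=
  forall i j : V n, edge i j -> exists q : HBT n, h i - h j = alpha i j * q.

Definition in_Hdeg n (t : nat) (h : VFun n) : Prop :=
  in_H h /\ forall i : V n, in_HBT t (h i).

Definition M n (v : V n) : VFun n :=
  [ffun j => if j == v then 0
             else if j == bar v then x n n - x n (n + 1) - f (bar v) *+ 2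
             else f v - f j].

Definition star n (K : {set V n}) : Prop :=
  K != set0 /\ forall i : V n, ~~ ([set i; bar i] \subset K).

(* For K = set0 this is 0, which is the convention for the empty set. *)
Definition Delta n (K : {set V n}) : VFun n :=
  [ffun j => if j \in K then \prod_(k | k \notin K :|: [set bar j]) (f k - f j)
             else 0].

(* Elementary symmetric polynomial of degree j in the family (r i), i in D;
   the exponents (a_i) in {0,1} are given by the set A of the i with a_i = 1,
   as in mesym. *)
Definition elsym (R : pzRingType) (I : finType) (D : {set I}) (r : I -> R)
    (j : nat) : R :=
  \sum_(A : {set I} | (A \subset D) && (#|A| == j)) \prod_(i in A) r i.

(* Main.v *)
(** At a vertex [j] one has [M v j = f v - f j] for every [v], because
  [f i + f (bar i)] does not depend on [i]; in particular [X j = M (bar j) j].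
  At [j] in [K :&: H] the left-hand side is therefore the product of the
  factors of [Delta (K :&: H) j] and of the [M v j] over the [v <> bar j] outside
  [K :|: H].  Since [~: (K :|: H)] has [k + 1] elements, one of which is [bar j],
  the latter product is the elementary symmetric polynomial of degree [k] in the
  family with [bar j] removed, and the alternating sum expresses it through
  the elementary symmetric polynomials of the whole family. *)
Require Import Defs.
From mathcomp Require Import all_boot all_order all_algebra.
From mathcomp Require Import zify ring.

Set Implicit Arguments.
Unset Strict Implicit.
Unset Printing Implicit Defensive.

Import GRing.Theory.
Local Open Scope ring_scope.

Section ElementarySymmetric.

Variables (R : comNzRingType) (I : finType).
Implicit Types (D A : {set I}) (r : I -> R).

Lemma elsym0 D r : elsym D r 0 = 1.
Proof.
rewrite /elsym (big_pred1 set0) ?big_set0 // => A /=.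
by rewrite cards_eq0 andbC; case: eqP => //= ->; rewrite sub0set.
Qed.

Lemma elsym_card D r : elsym D r #|D| = \prod_(i in D) r i.
Proof.
rewrite /elsym (big_pred1 D) // => A /=.
apply/andP/eqP => [[sAD /eqP cA]|->]; last by rewrite eqxx.
by apply/eqP; rewrite eqEcard sAD cA leqnn.
Qed.

(** The subsets of [D] are split by whether they contain [a]; those that do are [a |: A] with [A] a
    subset of [D :\ a]. *)
Lemma elsymS D r a m : a \in D ->
  elsym D r m.+1 = elsym (D :\ a) r m.+1 + r a * elsym (D :\ a) r m.
Proof.
move=> aD; rewrite /elsym (bigID (fun A => a \in A)) /= addrC; congr (_ + _).
  by apply: eq_bigl => A; rewrite subsetD1 andbAC.
rewrite (reindex_onto (fun A => a |: A) (fun A => A :\ a)) /=; last first.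
  by move=> A /andP[_ aA]; rewrite setD1K.
rewrite mulr_sumr; apply: eq_big => [A|A].
  rewrite setU11 andbT subUset sub1set aD /= subsetD1.
  have [aA|aA] := boolP (a \in A).
    rewrite andbF /=; apply/negbTE/negP => /andP[_ /eqP E].
    by move: aA; rewrite -E setD11.
  by rewrite setU1K // eqxx cardsU1 aA add1n eqSS !andbT.
move=> /andP[_ /eqP E]; rewrite big_setU1 //.
by rewrite -E setD11.
Qed.

(** Solving [elsymS] for its term in degree [m.+1] over [D :\ a] gives a recursion in [m]; unrolling
    it produces the alternating powers of [r a]. *)
Lemma elsym_setD1 D r a m : a \in D ->
  elsym (D :\ a) r m =
  \sum_(i < m.+1) (-1) ^+ i * r a ^+ i * elsym D r (m - i).
Proof.
move=> aD; elim: m => [|m IHm]; first by rewrite big_ord1 !elsym0 !expr0 !mul1r.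
rewrite big_ord_recl subn0 !expr0 !mul1r (elsymS _ _ aD) IHm.
under [X in _ = _ + X]eq_bigr => i _.
  rewrite lift0 subSS !exprS.
  have -> : -1 * (-1) ^+ i * (r a * r a ^+ i) * elsym D r (m - i) =
    - r a * ((-1) ^+ i * r a ^+ i * elsym D r (m - i)) by ring.
  over.
by rewrite -mulr_sumr mulNr addrK.
Qed.

End ElementarySymmetric.

Lemma ffun_mulE (T : finType) (R : pzSemiRingType) (g h : {ffun T -> R}) j :
  (g * h) j = g j * h j.
Proof. by rewrite ffunE. Qed.

Lemma ffun_expE (T : finType) (R : pzSemiRingType) (g : {ffun T -> R}) m j :
  (g ^+ m) j = g j ^+ m.
Proof. by elim: m => [|m IHm]; rewrite ?expr0 ?ffunE // !exprS ffun_mulE IHm. Qed.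

Lemma ffun_elsymE (T I : finType) (R : pzRingType) (D : {set I})
    (r : I -> {ffun T -> R}) m j :
  elsym D r m j = elsym D (fun i => r i j) m.
Proof.
rewrite /elsym sum_ffunE; apply: eq_bigr => A _.
apply: (big_morph (fun g : {ffun T -> R} => g j) (fun g h => ffun_mulE g h j)).
by rewrite ffunE.
Qed.

(** Has the shape of the edge condition in [in_H], so that condition can be multiplied factor by
    factor. *)
Definition congr_mod (R : pzRingType) (d a b : R) := exists q, a - b = d * q.

Lemma congr_modM (R : comPzRingType) (d a b a' b' : R) :
  congr_mod d a b -> congr_mod d a' b' -> congr_mod d (a * a') (b * b').
Proof.
move=> [q E] [q' E']; exists (q * a' + b * q').
have -> : a * a' - b * b' = (a - b) * a' + b * (a' - b') by ring.
by rewrite E E'; ring.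
Qed.

Lemma congr_mod_prod (R : comPzRingType) (I : finType) (P : pred I)
    (F G : I -> R) d :
  (forall i, P i -> congr_mod d (F i) (G i)) ->
  congr_mod d (\prod_(i | P i) F i) (\prod_(i | P i) G i).
Proof.
apply: big_ind2 => [|*]; last exact: congr_modM.
by exists 0; rewrite subrr mulr0.
Qed.

Lemma in_HM n (g h : VFun n) : in_H g -> in_H h -> in_H (g * h).
Proof.
move=> Hg Hh i j eij; rewrite !ffun_mulE.
exact: congr_modM (Hg i j eij) (Hh i j eij).
Qed.

Section Graph.

Variable n : nat.
Implicit Types (i j v : V n) (K H : {set V n}).

Lemma barK : involutive (@bar n).
Proof. exact: rev_ordK. Qed.

Lemma f_bar i : f i + f (bar i) = x n n - x n (n + 1).
Proof.
(* Here [i'] and [bar i'] fall in different branches of [f], and the two occurrences of [x n m]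
   cancel. *)
have Hlow (m : nat) : (m < n)%N -> forall i' : V n, i' = m :> nat ->
    f i' + f (bar i') = x n n - x n (n + 1).
  move=> ltmn i' Ei; rewrite /f /= Ei.
  have -> : (m.+1 <= n + 2)%N by lia.
  have -> : ((n.*2.+2 - m.+1).+1 <= n + 2)%N = false by lia.
  have -> : (m.+1 - 1 = m)%N by lia.
  have -> : (2 * n + 2 - (n.*2.+2 - m.+1).+1 = m)%N by lia.
  by ring.
(* The middle pair, of values [n] and [n + 1]: both fall in the first branch of [f]. *)
have Hmid i' : i' = n :> nat -> f i' + f (bar i') = x n n - x n (n + 1).
  move=> Ei; rewrite /f /= Ei.
  have -> : (n.+1 <= n + 2)%N by lia.
  have -> : ((n.*2.+2 - n.+1).+1 <= n + 2)%N by lia.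
  have -> : (n.+1 - 1 = n)%N by lia.
  have -> : ((n.*2.+2 - n.+1).+1 - 1 = n + 1)%N by lia.
  by ring.
have ltin := ltn_ord i.
have [lt|gt|eq] := ltngtP i n; [exact: (Hlow i) | | exact: Hmid].
have Ebar : bar i = (n.*2.+2 - i.+1)%N :> nat by [].
(* Above [n], exchanging [i] and [bar i] leads back to the previous cases. *)
rewrite addrC -[in f i](barK i).
have [lt'|eq'] : (bar i < n)%N \/ (bar i = n :> nat) by lia.
  exact: (Hlow (bar i)).
exact: Hmid.
Qed.

Lemma M_E v j : M v j = f v - f j.
Proof.
rewrite ffunE; case: eqP => [->|_]; first by rewrite subrr.
case: eqP => [->|//]; rewrite -(f_bar v) mulr2n; ring.
Qed.

Lemma M_barE v j : (M v + M (bar v)) j = f (bar j) - f j.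
Proof.
have -> : (M v + M (bar v)) j = M v j + M (bar v) j by rewrite ffunE.
rewrite !M_E.
have -> : f v - f j + (f (bar v) - f j) = f v + f (bar v) - f j - f j by ring.
by rewrite f_bar -(f_bar j); ring.
Qed.

Lemma bar_notin K i : star K -> i \in K -> bar i \notin K.
Proof.
by move=> [_ /(_ i)]; rewrite subUset !sub1set => + iK; rewrite iK.
Qed.

(** If just one end of the edge is in [K], the other end contributes the factor [alpha i j] up to
    sign. If both are, the factor of [bar j] at [i] equals that of [bar i] at [j], and the remaining
    factors are congruent one by one. *)
Lemma in_H_Delta K : star K -> in_H (Delta K).
Proof.
move=> sK.
have dvd i j : edge i j -> i \in K -> j \notin K ->
    exists q, Delta K i = alpha i j * q.
  move=> /andP[_ jbi] iK jK; rewrite ffunE iK (bigD1 j) /=; last first.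
    by rewrite !inE negb_or jK.
  by eexists.
move=> i j eij; have /andP[ji jbi] := eij.
have [iK|iK] := boolP (i \in K); have [jK|jK] := boolP (j \in K).
- rewrite !ffunE iK jK.
  have biK := bar_notin sK iK; have bjK := bar_notin sK jK.
  have bij : bar j != bar i by rewrite (can_eq barK).
  rewrite (bigD1 (bar j)) ?inE ?negb_or ?bjK //=.
  rewrite [X in _ - X](bigD1 (bar i)) ?inE ?negb_or ?biK 1?eq_sym //=.
  apply: congr_modM.
    have Eij : f (bar i) + f i = f (bar j) + f j.
      by rewrite ![f (bar _) + _]addrC !f_bar.
    exists 0; rewrite mulr0.
    have -> : f (bar i) = f (bar j) + f j - f i by rewrite -Eij addrK.
    by ring.
  rewrite [X in congr_mod _ _ X](eq_bigl
    (fun k => (k \notin K :|: [set bar i]) && (k != bar j))).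
    apply: congr_mod_prod => k _; exists 1; rewrite /alpha; ring.
  by move=> k; rewrite !inE !negb_or andbAC.
- have [q ->] := dvd i j eij iK jK.
  by exists q; rewrite ffunE (negbTE jK) subr0.
- have eji : edge j i.
    rewrite /edge eq_sym ji /=; apply/negP => /eqP E.
    by move: jbi; rewrite E barK eqxx.
  have [q ->] := dvd j i eji jK iK.
  exists q; rewrite ffunE (negbTE iK) /alpha; ring.
by exists 0; rewrite !ffunE (negbTE iK) (negbTE jK) subr0 mulr0.
Qed.

Lemma in_HBT_homog d (p : HBT n) : p \is d.-homog -> in_HBT (2 * d) p.
Proof.
by move=> /dhomogP hp; apply/allP => m /hp /= <-.
Qed.

Lemma x_homog k : x n k \is 1.-homog.
Proof.
by case: k => [|k]; rewrite /x ?rpred0 // dhomogX /= mdeg1.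
Qed.

Lemma f_homog i : f i \is 1.-homog.
Proof. by rewrite /f; case: ifP => _; rewrite rpredB ?x_homog. Qed.

Lemma prod_homog (I : finType) (P : pred I) (F : I -> HBT n) :
  (forall t, P t -> F t \is 1.-homog) ->
  \prod_(t | P t) F t \is #|P|.-homog.
Proof.
move=> hF; rewrite -sum1_card.
apply: (big_ind2 (fun (p : HBT n) d => p \is d.-homog)) => //.
- exact: dhomog1.
- by move=> p d q e; apply: dhomogM.
Qed.

Lemma Delta_homog K j : star K -> #|K| = n.+1 -> Delta K j \is n.-homog.
Proof.
move=> sK cK; rewrite ffunE; case: ifP => jK; last exact: rpred0.
have cP : #|[pred k | k \notin K :|: [set bar j]]| = n.
  have -> : #|[pred k | k \notin K :|: [set bar j]]| = #|~: (bar j |: K)|.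
    by apply: eq_card => k; rewrite !inE orbC.
  (* As [bar j] is outside [K], there remain [(2n+2) - (n+1) - 1 = n] factors. *)
  have := cardsC (bar j |: K); rewrite card_ord cardsU1 bar_notin // cK; lia.
have : \prod_(k | k \notin K :|: [set bar j]) (f k - f j)
    \is #|[pred k | k \notin K :|: [set bar j]]|.-homog.
  by apply: prod_homog => k _; rewrite rpredB ?f_homog.
by rewrite cP.
Qed.

(* Both sides have a factor [f k - f j] squared, single or absent according to
   whether [k] lies in none, exactly one or both of [K] and [H]. *)
Lemma Delta_mul_setI K H j : j \in K :&: H ->
  Delta K j * Delta H j =
  Delta (K :&: H) j *
  \prod_(k in ~: (K :|: H) :\ bar j) (f k - f j).
Proof.
move=> jKH; have := jKH; rewrite inE => /andP[jK jH].
rewrite !ffunE jK jH jKH.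
rewrite [in LHS]big_mkcond [X in _ * X = _]big_mkcond.
rewrite [X in _ = X * _]big_mkcond [X in _ = _ * X]big_mkcond -!big_split /=.
apply: eq_bigr => k _; rewrite !inE.
by case: (k == bar j); case: (k \in K); case: (k \in H) => //=;
  rewrite ?mul1r ?mulr1.
Qed.

Lemma card_setC_setU K H : #|K| = n.+1 -> #|H| = n.+1 ->
  #|~: (K :|: H)| = #|K :&: H|.
Proof.
move=> cK cH; have := cardsC (K :|: H); have := cardsUI K H.
rewrite card_ord; lia.
Qed.

End Graph.

(* k = #|K :&: H| - 1, so the sum over 0 <= i <= k is the sum over
   i < #|K :&: H|; it is empty when K and H are disjoint. *)
Theorem theorem6p1 (n : nat) (K H : {set V n}) :
  (1 <= n)%N -> star K -> star H -> #|K| = n.+1 -> #|H| = n.+1 ->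
  forall v0 : V n,
  let X : VFun n := M v0 + M (bar v0) in
  [/\ in_Hdeg 2 X,
      forall v : V n, M v + M (bar v) = X,
      Delta K * Delta H =
        Delta (K :&: H) *
        (\sum_(i < #|K :&: H|)
           (-1) ^+ i * X ^+ i *
           elsym (~: (K :|: H)) (@M n) (#|K :&: H| - 1 - i)%N)
    & in_Hdeg (4 * n) (Delta K * Delta H)].
Proof.
move=> _ sK sH cK cH v0 X.
have XE j : X j = f (bar j) - f j by apply: M_barE.
split.
- split=> [i j _|i]; last first.
    by apply: (@in_HBT_homog n 1); rewrite XE rpredB ?f_homog.
  (* Since [f i + f (bar i)] is constant, [X i - X j] is twice [f j - f i]. *)
  exists 2; rewrite !XE /alpha.
  have -> : f (bar i) = f j + f (bar j) - f i.
    by rewrite f_bar -(f_bar i) addrC addKr.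
  by ring.
- by move=> v; apply/ffunP => j; rewrite XE M_barE.
- apply/ffunP => j; rewrite !ffun_mulE.
  have [jKH|jKH] := boolP (j \in K :&: H); last first.
    rewrite [Delta (_ :&: _) j]ffunE (negbTE jKH) mul0r !ffunE.
    by move: jKH; rewrite inE negb_and => /orP[] /negbTE ->;
      rewrite ?mul0r ?mulr0.
  rewrite Delta_mul_setI //; congr (_ * _).
  set D := ~: (K :|: H).
  have bD : bar j \in D.
    by move: jKH; rewrite !inE negb_or => /andP[jK jH]; rewrite !bar_notin.
  have cD : #|K :&: H| = #|D :\ bar j|.+1.
    by rewrite -(card_setC_setU cK cH) (cardsD1 (bar j)) bD.
  (* The product over [D :\ bar j] is its elementary symmetric polynomial of top degree, to be
     expanded with [a := bar j], where [r a] is [X j]. *)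
  rewrite sum_ffunE cD subn1 /= -(elsym_card _ (fun k => f k - f j)).
  rewrite elsym_setD1 //; apply: eq_bigr => i _.
  rewrite !ffun_mulE !ffun_expE ffun_elsymE XE; congr (_ * _ * _).
    by rewrite !ffunE.
  by apply: eq_bigr => A _; apply: eq_bigr => k _; rewrite M_E.
- split=> [|j]; first by apply: in_HM; apply: in_H_Delta.
  have -> : (4 * n = 2 * (n + n))%N by lia.
  by apply: in_HBT_homog; rewrite ffun_mulE dhomogM ?Delta_homog.
Qed.
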